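(* Let $(\Sigma,R)$ be a $3$-polygraph (with one $0$-cell and one $1$-cell). Let $X$ and $Y$ be non-empty ordered sets, and let $M$ be a commutative monoid (written additively) equipped with an order relation for which the sum is strictly monotone in both arguments. For each $2$-cell $\phi:m\to n$ in $\Sigma$, let $$\phi_*:X^m\to X^n,\qquad \phi^*:Y^n\to Y^m,\qquad [\phi]:X^m\times Y^n\to M$$ be monotone maps. Extend the interpretations $(\cdot)_*$, $(\cdot)^*$ and $[\cdot]$ to all circuits of $\langle\Sigma\rangle$, and let $>$ be the binary relation on parallel circuits of $\langle\Sigma\rangle$ defined as follows: for $f,g:m\to n$, $f>g$ if and only if for all $\vec{x}\in X^m$ and $\vec{y}\in Y^n$ one has $f_*(\vec{x})\geq g_*(\vec{x})$, $f^*(\vec{y})\geq g^*(\vec{y})$ and $[f](\vec{x},\vec{y})>[g](\vec{x},\vec{y})$. Assume that the order relation on $M$ does not admit infinite strictly decreasing sequences. Then the binary relation $>$ on parallel circuits of $\langle\Sigma\rangle$ is a termination order on $\Sigma$. In particular, if every $3$-cell $\alpha\in R$ with source $f$ and target $g$ satisfies $f>g$, then the $3$-polygraph $(\Sigma,R)$ terminates.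
   Context: All polygraphs have one $0$-cell and one $1$-cell. A $2$-polygraph $\Sigma$ is a graph over the set $\mathbb{N}$ of natural numbers: a set of elements ($2$-cells), each $\phi:m\to n$ having a source $m\in\mathbb{N}$ (number of inputs) and a target $n\in\mathbb{N}$ (number of outputs). The circuits of $\langle\Sigma\rangle$ are all those built from the $2$-cells of $\Sigma$ and the identity circuits $n:n\to n$ ($n\in\mathbb{N}$, consisting of $n$ parallel wires) by horizontal juxtaposition $\star_0$ and vertical plugging $\star_1$. If $f:m\to n$ and $g:m'\to n'$, then $f\star_0 g:m+m'\to n+n'$. If $f:m\to n$ and $g:n\to p$, then $f\star_1 g:m\to p$ (the outputs of $f$ are plugged into the inputs of $g$). Circuits are considered modulo isotopy: $\star_0$ and $\star_1$ are associative, with the identity circuits as units ($0$ is the unit of $\star_0$; $m\star_1 f=f=f\star_1 n$ for $f:m\to n$), $m\star_0 n=m+n$ on identity circuits, and the exchange law $(f\star_0 g)\star_1(f'\star_0 g')=(f\star_1 f')\star_0(g\star_1 g')$ holds whenever both sides are defined. In other words, $\langle\Sigma\rangle$ is the free strict monoidal category with monoid of objects $(\mathbb{N},+,0)$ generated by $\Sigma$. Two circuits are parallel when they have the same source and the same target. A $3$-polygraph is a pair $(\Sigma,R)$ where $\Sigma$ is a $2$-polygraph and $R$ is a set of arrows ($3$-cells) $\alpha:f\to g$, each having as source and target two parallel circuits $f,g$ of $\langle\Sigma\rangle$. The reduction relation generated by $R$ is the binary relation $\to_R$ on circuits of $\langle\Sigma\rangle$ such that $f\to_R g$ if and only if there exist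 a $3$-cell $\alpha:f_0\to g_0$ in $R$, circuits $h,k$ and natural numbers $p,q$ such that $f=h\star_1(p\star_0 f_0\star_0 q)\star_1 k$ and $g=h\star_1(p\star_0 g_0\star_0 q)\star_1 k$ (the composites being defined). The $3$-polygraph $(\Sigma,R)$ terminates if there exists no family $(f_n)_{n\in\mathbb{N}}$ of circuits of $\langle\Sigma\rangle$ such that $f_n\to_R f_{n+1}$ for every $n\in\mathbb{N}$. A termination order on a $2$-polygraph $\Sigma$ is a strict order $>$ on parallel circuits of $\langle\Sigma\rangle$ (an irreflexive transitive relation comparing only parallel circuits) such that there exists no family $(f_n)_{n\in\mathbb{N}}$ of circuits with $f_n>f_{n+1}$ for every $n$, and such that, for every circuit $f$, the maps $f\star_0(\cdot)$, $(\cdot)\star_0 f$, $f\star_1(\cdot)$ and $(\cdot)\star_1 f$ are strictly monotone with respect to $>$ (on the circuits for which they are defined). Products such as $X^m$, $Y^n$ and $X^m\times Y^n$ carry the componentwise (product) order; monotone means order-preserving (non-strictly). Strict monotonicity of the sum in $M$ means that $a<a'$ implies $a+b<a'+b$ and $b+a<b+a'$. Extension of the interpretations to circuits: every circuit $f:m\to n$ of $\langle\Sigma\rangle$ receives maps $f_*:X^m\to X^n$, $f^*:Y^n\to Y^m$ and $[f]:X^m\times Y^n\to M$, given on $2$-cells by the chosen maps and extended by the following rules (they are well defined on circuits modulo isotopy, and the resulting maps are monotone). Identity circuits: $n_*=\mathrm{Id}_{X^n}$, $n^*=\mathrm{Id}_{Y^n}$, $[n](\vec{x},\vec{y})=0$.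 Juxtaposition: $(f\star_0 g)_*=(f_*,g_* )$, $(f\star_0 g)^*=(f^*,g^* )$ (acting blockwise), and $[f\star_0 g](\vec{x},\vec{x}',\vec{y},\vec{y}')=[f](\vec{x},\vec{y})+[g](\vec{x}',\vec{y}')$, where $\vec{x},\vec{y}$ are the arguments for $f$ and $\vec{x}',\vec{y}'$ those for $g$. Plugging: $(f\star_1 g)_*=g_*\circ f_*$, $(f\star_1 g)^*=f^*\circ g^*$, and $[f\star_1 g](\vec{x},\vec{y})=[f](\vec{x},g^*(\vec{y}))+[g](f_*(\vec{x}),\vec{y})$. *)

(* Defs.v *)
From HB Require Import structures.
From mathcomp Require Import all_boot all_order.
From mathcomp Require Import boolp.

Set Implicit Arguments.
Unset Strict Implicit.
Unset Printing Implicit Defensive.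

(* [n.-tuple T] carries the componentwise order. *)
Import Order.DefaultTupleProdOrder.

Local Open Scope quotient_scope.
Local Open Scope order_scope.

Record polygraph2 := Polygraph2 {
  cell2 :> Type;
  src2 : cell2 -> nat;
  tgt2 : cell2 -> nat }.

Inductive term (S : polygraph2) : nat -> nat -> Type :=
| TGen (c : S) : term S (src2 c) (tgt2 c)
| TId (n : nat) : term S n n
| TJuxt m n m' n' : term S m n -> term S m' n' -> term S (m + m') (n + n')
| TPlug m n p : term S m n -> term S n p -> term S m p.

Arguments TId {S} n.

(* Isotopy.  The relation is heterogeneous because the two sides of, e.g.,    *)
(* [iso_juxtA] have types that are only propositionally equal; isotopic terms *)
(* always have equal sources and equal targets ([iso_type] below).            *)
Inductive iso (S : polygraph2) :
  forall m n m' n', term S m n -> term S m' n' -> Prop :=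
| iso_refl m n (f : term S m n) : iso f f
| iso_sym m n m' n' (f : term S m n) (g : term S m' n') : iso f g -> iso g f
| iso_trans m n m' n' m'' n''
    (f : term S m n) (g : term S m' n') (h : term S m'' n'') :
    iso f g -> iso g h -> iso f h
| iso_juxt m n p q m' n' p' q'
    (f : term S m n) (g : term S p q) (f' : term S m' n') (g' : term S p' q') :
    iso f f' -> iso g g' -> iso (TJuxt f g) (TJuxt f' g')
| iso_plug m n p m' n' p'
    (f : term S m n) (g : term S n p) (f' : term S m' n') (g' : term S n' p') :
    iso f f' -> iso g g' -> iso (TPlug f g) (TPlug f' g')
| iso_juxtA m n m' n' m'' n''
    (f : term S m n) (g : term S m' n') (h : term S m'' n'') :
    iso (TJuxt f (TJuxt g h)) (TJuxt (TJuxt f g) h)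
| iso_plugA m n p q (f : term S m n) (g : term S n p) (h : term S p q) :
    iso (TPlug f (TPlug g h)) (TPlug (TPlug f g) h)
| iso_juxt0l m n (f : term S m n) : iso (TJuxt (TId 0) f) f
| iso_juxt0r m n (f : term S m n) : iso (TJuxt f (TId 0)) f
| iso_plug1l m n (f : term S m n) : iso (TPlug (TId m) f) f
| iso_plug1r m n (f : term S m n) : iso (TPlug f (TId n)) f
| iso_juxtId m n : iso (TJuxt (@TId S m) (@TId S n)) (@TId S (m + n))
| iso_exchange m n p m' n' p'
    (f : term S m n) (g : term S m' n') (f' : term S n p) (g' : term S n' p') :
    iso (TPlug (TJuxt f g) (TJuxt f' g')) (TJuxt (TPlug f f') (TPlug g g')).

Lemma iso_type S m n m' n' (f : term S m n) (g : term S m' n') :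
  iso f g -> m = m' /\ n = n'.
Proof.
elim=> {m n m' n' f g} //=; try by intuition congruence.
- by move=> *; rewrite !addnA.
- by move=> *; rewrite !addn0.
Qed.

HB.instance Definition _ S m n := gen_eqMixin (term S m n).
HB.instance Definition _ S m n := gen_choiceMixin (term S m n).

Section Circuits.
Variable S : polygraph2.

Definition isob m n (f g : term S m n) : bool := `[< iso f g >].

Lemma isob_refl m n : reflexive (@isob m n).
Proof. by move=> f; apply/asboolP; apply: iso_refl. Qed.

Lemma isob_sym m n : symmetric (@isob m n).
Proof. by move=> f g; apply: asbool_equiv_eq; split; apply: iso_sym. Qed.

Lemma isob_trans m n : transitive (@isob m n).
Proof.
by move=> g f h /asboolP fg /asboolP gh; apply/asboolP; apply: iso_trans gh.
Qed.

Canonical isob_equiv m n :=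
  EquivRel (@isob m n) (@isob_refl m n) (@isob_sym m n) (@isob_trans m n).

Definition circuit m n := {eq_quot (@isob_equiv m n)}.

Definition gen (c : S) : circuit (src2 c) (tgt2 c) :=
  \pi_(circuit (src2 c) (tgt2 c)) (TGen c).

Definition idc n : circuit n n := \pi_(circuit n n) (TId n).

Definition juxt m n m' n' (f : circuit m n) (g : circuit m' n') :
  circuit (m + m') (n + n') :=
  \pi_(circuit (m + m') (n + n')) (TJuxt (repr f) (repr g)).

Definition plug m n p (f : circuit m n) (g : circuit n p) : circuit m p :=
  \pi_(circuit m p) (TPlug (repr f) (repr g)).

Lemma circuit_eqP m n (f g : term S m n) :
  iso f g <-> \pi_(circuit m n) f = \pi_(circuit m n) g.
Proof.
split=> [fg|/eqmodP/asboolP //].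
by apply/eqmodP/asboolP.
Qed.

Lemma iso_repr m n (f : term S m n) : iso (repr (\pi_(circuit m n) f)) f.
Proof. by apply/circuit_eqP; rewrite reprK. Qed.

Lemma pi_juxt m n m' n' (f : term S m n) (g : term S m' n') :
  juxt (\pi_(circuit m n) f) (\pi_(circuit m' n') g) =
  \pi_(circuit (m + m') (n + n')) (TJuxt f g).
Proof. by apply/circuit_eqP; apply: iso_juxt; apply: iso_repr. Qed.

Lemma pi_plug m n p (f : term S m n) (g : term S n p) :
  plug (\pi_(circuit m n) f) (\pi_(circuit n p) g) =
  \pi_(circuit m p) (TPlug f g).
Proof. by apply/circuit_eqP; apply: iso_plug; apply: iso_repr. Qed.

End Circuits.

Arguments idc {S} n.

Definition circuit_rel (S : polygraph2) :=
  forall m n, circuit S m n -> circuit S m n -> Prop.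

Record polygraph3 := Polygraph3 {
  base2 :> polygraph2;
  cell3 : Type;
  src3 : cell3 -> nat;
  tgt3 : cell3 -> nat;
  lhs : forall a : cell3, circuit base2 (src3 a) (tgt3 a);
  rhs : forall a : cell3, circuit base2 (src3 a) (tgt3 a) }.

Definition reduces (P : polygraph3) : circuit_rel P :=
  fun m n f g => exists (a : cell3 P) (p q : nat)
    (h : circuit P m (p + src3 a + q)) (k : circuit P (p + tgt3 a + q) n),
    f = plug (plug h (juxt (juxt (idc p) (lhs a)) (idc q))) k /\
    g = plug (plug h (juxt (juxt (idc p) (rhs a)) (idc q))) k.

Definition no_infinite_chain (S : polygraph2) (r : circuit_rel S) :=
  ~ exists (m n : nat) (f : nat -> circuit S m n), forall k, r m n (f k) (f k.+1).

Definition terminates (P : polygraph3) := no_infinite_chain (@reduces P).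

Record termination_order (S : polygraph2) (gt : circuit_rel S) : Prop := {
  to_irr : forall m n (f : circuit S m n), ~ gt m n f f;
  to_trans : forall m n (f g h : circuit S m n),
    gt m n f g -> gt m n g h -> gt m n f h;
  to_wf : no_infinite_chain gt;
  to_juxtl : forall m n m' n' (f : circuit S m n) (g h : circuit S m' n'),
    gt m' n' g h -> gt _ _ (juxt f g) (juxt f h);
  to_juxtr : forall m n m' n' (f : circuit S m n) (g h : circuit S m' n'),
    gt m' n' g h -> gt _ _ (juxt g f) (juxt h f);
  to_plugl : forall m n p (f : circuit S m n) (g h : circuit S n p),
    gt n p g h -> gt _ _ (plug f g) (plug f h);
  to_plugr : forall m n p (f : circuit S n p) (g h : circuit S m n),
    gt m n g h -> gt _ _ (plug g f) (plug h f) }.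

Section Blocks.
Variables (T : Type) (m n : nat).

Lemma lblockP (x : (m + n).-tuple T) : size (take m x) == m.
Proof. by rewrite size_takel // size_tuple leq_addr. Qed.

Lemma rblockP (x : (m + n).-tuple T) : size (drop m x) == n.
Proof. by rewrite size_drop size_tuple addKn. Qed.

Definition lblock x : m.-tuple T := Tuple (lblockP x).
Definition rblock x : n.-tuple T := Tuple (rblockP x).

End Blocks.

Section Interpretation.
Context (S : polygraph2) (dX dY dM : Order.disp_t).
Context (X : porderType dX) (Y : porderType dY) (M : porderType dM).
Context (zero : M) (add : Monoid.com_law zero).

(* [cov c], [contra c] and [heat c] are the maps usually written c_*, c^* and  *)
(* [c]; [ccov], [ccontra] and [cheat] are their extensions to circuits.       *)
Record interp := Interp {
  cov : forall c : S, (src2 c).-tuple X -> (tgt2 c).-tuple X;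
  contra : forall c : S, (tgt2 c).-tuple Y -> (src2 c).-tuple Y;
  heat : forall c : S, (src2 c).-tuple X -> (tgt2 c).-tuple Y -> M }.

Definition monotone (I : interp) : Prop :=
  [/\ forall c, {homo cov I (c := c) : x x' / x <= x'},
      forall c, {homo contra I (c := c) : y y' / y <= y'} &
      forall (c : S) (x x' : (src2 c).-tuple X) (y y' : (tgt2 c).-tuple Y),
        x <= x' -> y <= y' ->
        heat I (c := c) x y <= heat I (c := c) x' y'].

Variable I : interp.

Fixpoint tcov m n (f : term S m n) : m.-tuple X -> n.-tuple X :=
  match f with
  | TGen c => cov I (c := c)
  | TId n => id
  | TJuxt _ _ _ _ f g => fun x => [tuple of tcov f (lblock x) ++ tcov g (rblock x)]
  | TPlug _ _ _ f g => fun x => tcov g (tcov f x)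
  end.

Fixpoint tcontra m n (f : term S m n) : n.-tuple Y -> m.-tuple Y :=
  match f with
  | TGen c => contra I (c := c)
  | TId n => id
  | TJuxt _ _ _ _ f g =>
      fun y => [tuple of tcontra f (lblock y) ++ tcontra g (rblock y)]
  | TPlug _ _ _ f g => fun y => tcontra f (tcontra g y)
  end.

Fixpoint theat m n (f : term S m n) : m.-tuple X -> n.-tuple Y -> M :=
  match f with
  | TGen c => heat I (c := c)
  | TId n => fun _ _ => zero
  | TJuxt _ _ _ _ f g => fun x y =>
      add (theat f (lblock x) (lblock y)) (theat g (rblock x) (rblock y))
  | TPlug _ _ _ f g => fun x y =>
      add (theat f x (tcontra g y)) (theat g (tcov f x) y)
  end.

Definition ccov m n (f : circuit S m n) := tcov (repr f).
Definition ccontra m n (f : circuit S m n) := tcontra (repr f).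
Definition cheat m n (f : circuit S m n) := theat (repr f).

Definition interp_gt : circuit_rel S := fun m n f g =>
  forall (x : m.-tuple X) (y : n.-tuple Y),
    [/\ ccov f x >= ccov g x, ccontra f y >= ccontra g y &
        cheat f x y > cheat g x y].

Lemma iso_tcov m n m' n' (f : term S m n) (g : term S m' n') : iso f g ->
  forall (x : m.-tuple X) (x' : m'.-tuple X),
    x = x' :> seq X -> tcov f x = tcov g x' :> seq X.
Proof.
elim=> {m n m' n' f g} /=.
- by move=> m n f x x' /val_inj ->.
- by move=> m n m' n' f g _ IH x x' xx'; rewrite (IH x' x).
- move=> m n m' n' m'' n'' f g h fg IHf gh IHg x x' xx'.
  have [e _] := iso_type fg; rewrite (IHf x (tcast e x)) ?val_tcast //.
  by apply: IHg; rewrite val_tcast.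
- move=> m n p q m' n' p' q' f g f' g' ff' IHf gg' IHg x x' xx'.
  have [e _] := iso_type ff'.
  by congr (_ ++ _); [apply: IHf | apply: IHg]; rewrite /= xx' e.
- by move=> m n p m' n' p' f g f' g' _ IHf _ IHg x x' xx'; apply/IHg/IHf.
- move=> m n m' n' m'' n'' f g h x x' xx'; rewrite -catA.
  congr (_ ++ (_ ++ _)); congr (tval (tcov _ _)); apply: val_inj => /=.
  + by rewrite xx' take_takel // leq_addr.
  + by rewrite xx' take_drop addnC.
  + by rewrite xx' drop_drop addnC.
- by move=> m n p q f g h x x' /val_inj ->.
- move=> m n f x x' xx'; rewrite take0 /=.
  by have -> : rblock x = x' by apply: val_inj; rewrite /= drop0.
- move=> m n f x x' xx'.
  have -> : lblock x = x'.
    by apply: val_inj; rewrite /= take_oversize // size_tuple addn0.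
  by rewrite drop_oversize ?cats0 // size_tuple addn0.
- by move=> m n f x x' /val_inj ->.
- by move=> m n f x x' /val_inj ->.
- by move=> m n x x' <-; rewrite /= cat_take_drop.
- move=> m n p m' n' p' f g f' g' x x' /val_inj <-.
  by congr (_ ++ _); congr (tval (tcov _ _)); apply: val_inj;
    rewrite /= ?take_size_cat ?drop_size_cat ?size_tuple.
Qed.

Lemma iso_tcontra m n m' n' (f : term S m n) (g : term S m' n') : iso f g ->
  forall (y : n.-tuple Y) (y' : n'.-tuple Y),
    y = y' :> seq Y -> tcontra f y = tcontra g y' :> seq Y.
Proof.
elim=> {m n m' n' f g} /=.
- by move=> m n f y y' /val_inj ->.
- by move=> m n m' n' f g _ IH y y' yy'; rewrite (IH y' y).
- move=> m n m' n' m'' n'' f g h fg IHf gh IHg y y' yy'.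
  have [_ e] := iso_type fg; rewrite (IHf y (tcast e y)) ?val_tcast //.
  by apply: IHg; rewrite val_tcast.
- move=> m n p q m' n' p' q' f g f' g' ff' IHf gg' IHg y y' yy'.
  have [_ e] := iso_type ff'.
  by congr (_ ++ _); [apply: IHf | apply: IHg]; rewrite /= yy' e.
- by move=> m n p m' n' p' f g f' g' _ IHf _ IHg y y' yy'; apply/IHf/IHg.
- move=> m n m' n' m'' n'' f g h y y' yy'; rewrite -catA.
  congr (_ ++ (_ ++ _)); congr (tval (tcontra _ _)); apply: val_inj => /=.
  + by rewrite yy' take_takel // leq_addr.
  + by rewrite yy' take_drop addnC.
  + by rewrite yy' drop_drop addnC.
- by move=> m n p q f g h y y' /val_inj ->.
- move=> m n f y y' yy'; rewrite take0 /=.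
  by have -> : rblock y = y' by apply: val_inj; rewrite /= drop0.
- move=> m n f y y' yy'.
  have -> : lblock y = y'.
    by apply: val_inj; rewrite /= take_oversize // size_tuple addn0.
  by rewrite drop_oversize ?cats0 // size_tuple addn0.
- by move=> m n f y y' /val_inj ->.
- by move=> m n f y y' /val_inj ->.
- by move=> m n y y' <-; rewrite /= cat_take_drop.
- move=> m n p m' n' p' f g f' g' y y' /val_inj <-.
  by congr (_ ++ _); congr (tval (tcontra _ _)); apply: val_inj;
    rewrite /= ?take_size_cat ?drop_size_cat ?size_tuple.
Qed.

Lemma iso_theat m n m' n' (f : term S m n) (g : term S m' n') : iso f g ->
  forall (x : m.-tuple X) (x' : m'.-tuple X) (y : n.-tuple Y) (y' : n'.-tuple Y),
    x = x' :> seq X -> y = y' :> seq Y -> theat f x y = theat g x' y'.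
Proof.
elim=> {m n m' n' f g} /=.
- by move=> m n f x x' y y' /val_inj -> /val_inj ->.
- by move=> m n m' n' f g _ IH x x' y y' xx' yy'; rewrite (IH x' x y' y).
- move=> m n m' n' m'' n'' f g h fg IHf gh IHg x x' y y' xx' yy'.
  have [e e'] := iso_type fg.
  rewrite (IHf x (tcast e x) y (tcast e' y)) ?val_tcast //.
  by apply: IHg; rewrite val_tcast.
- move=> m n p q m' n' p' q' f g f' g' ff' IHf gg' IHg x x' y y' xx' yy'.
  have [e e'] := iso_type ff'.
  by congr (add _ _); [apply: IHf | apply: IHg]; rewrite /= ?xx' ?yy' ?e ?e'.
- move=> m n p m' n' p' f g f' g' ff' IHf gg' IHg x x' y y' xx' yy'.
  by congr (add _ _); [apply: IHf | apply: IHg] => //;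
    [apply: iso_tcontra | apply: iso_tcov].
- move=> m n m' n' m'' n'' f g h x x' y y' xx' yy'; rewrite Monoid.mulmA.
  by congr (add (add _ _) _); congr (theat _ _ _); apply: val_inj => /=;
    rewrite ?xx' ?yy' ?drop_drop ?take_drop ?take_takel ?leq_addr 1?addnC.
- move=> m n p q f g h x x' y y' /val_inj -> /val_inj ->.
  by rewrite Monoid.mulmA.
- move=> m n f x x' y y' xx' yy'; rewrite Monoid.mul1m.
  by congr (theat _ _ _); apply: val_inj; rewrite /= drop0.
- move=> m n f x x' y y' xx' yy'; rewrite Monoid.mulm1.
  have -> : lblock x = x'.
    by apply: val_inj; rewrite /= take_oversize // size_tuple addn0.
  have -> // : lblock y = y'.
  by apply: val_inj; rewrite /= take_oversize // size_tuple addn0.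
- by move=> m n f x x' y y' /val_inj -> /val_inj ->; rewrite Monoid.mul1m.
- by move=> m n f x x' y y' /val_inj -> /val_inj ->; rewrite Monoid.mulm1.
- by move=> m n x x' y y' _ _; rewrite Monoid.mul1m.
- move=> m n p m' n' p' f g f' g' x x' y y' /val_inj <- /val_inj <-.
  rewrite Monoid.mulmACA.
  by congr (add (add _ _) (add _ _)); congr (theat _ _ _); apply: val_inj;
    rewrite /= ?take_size_cat ?drop_size_cat ?size_tuple.
Qed.

Lemma ccov_pi m n (f : term S m n) : ccov (\pi_(circuit S m n) f) =1 tcov f.
Proof. by move=> x; apply/val_inj/iso_tcov => //; apply: iso_repr. Qed.

Lemma ccontra_pi m n (f : term S m n) :
  ccontra (\pi_(circuit S m n) f) =1 tcontra f.
Proof. by move=> y; apply/val_inj/iso_tcontra => //; apply: iso_repr. Qed.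

Lemma cheat_pi m n (f : term S m n) x y :
  cheat (\pi_(circuit S m n) f) x y = theat f x y.
Proof. by apply: iso_theat => //; apply: iso_repr. Qed.

Lemma ccov_gen c : ccov (gen c) =1 cov I (c := c).
Proof. exact: ccov_pi. Qed.

Lemma ccov_id n : ccov (idc n) =1 id.
Proof. exact: ccov_pi. Qed.

Lemma ccov_juxt m n m' n' (f : circuit S m n) (g : circuit S m' n') x :
  ccov (juxt f g) x = [tuple of ccov f (lblock x) ++ ccov g (rblock x)].
Proof. exact: ccov_pi. Qed.

Lemma ccov_plug m n p (f : circuit S m n) (g : circuit S n p) x :
  ccov (plug f g) x = ccov g (ccov f x).
Proof. exact: ccov_pi. Qed.

Lemma ccontra_gen c : ccontra (gen c) =1 contra I (c := c).
Proof. exact: ccontra_pi. Qed.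

Lemma ccontra_id n : ccontra (idc n) =1 id.
Proof. exact: ccontra_pi. Qed.

Lemma ccontra_juxt m n m' n' (f : circuit S m n) (g : circuit S m' n') y :
  ccontra (juxt f g) y =
    [tuple of ccontra f (lblock y) ++ ccontra g (rblock y)].
Proof. exact: ccontra_pi. Qed.

Lemma ccontra_plug m n p (f : circuit S m n) (g : circuit S n p) y :
  ccontra (plug f g) y = ccontra f (ccontra g y).
Proof. exact: ccontra_pi. Qed.

Lemma cheat_gen c x y : cheat (gen c) x y = heat I x y.
Proof. exact: cheat_pi. Qed.

Lemma cheat_id n x y : cheat (idc n) x y = zero.
Proof. exact: cheat_pi. Qed.

Lemma cheat_juxt m n m' n' (f : circuit S m n) (g : circuit S m' n') x y :
  cheat (juxt f g) x y =
    add (cheat f (lblock x) (lblock y)) (cheat g (rblock x) (rblock y)).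
Proof. exact: cheat_pi. Qed.

Lemma cheat_plug m n p (f : circuit S m n) (g : circuit S n p) x y :
  cheat (plug f g) x y = add (cheat f x (ccontra g y)) (cheat g (ccov f x) y).
Proof. exact: cheat_pi. Qed.

End Interpretation.

(* Main.v *)
(* All interpretations of circuits are monotone.  Hence, when [g > h] is put  *)
(* in a context, the heat of [g] drops strictly while the heat of the context *)
(* can only drop: it receives the smaller outputs of [h_*] and [h^*].         *)
(* Evaluating at one fixed point, which exists as [X] and [Y] are non-empty,  *)
(* turns an infinite descent of circuits into one in [M].                     *)

Require Import Defs.
From mathcomp Require Import all_boot all_order.

Set Implicit Arguments.
Unset Strict Implicit.
Unset Printing Implicit Defensive.

Import Order.TTheory Order.DefaultTupleProdOrder.
Local Open Scope order_scope.

(** The strict drop of heat required by [>] must survive every context. Monotonicity of the 2-cell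
    maps passes to all circuits by induction ([tcov_homo], [tcontra_homo], [theat_homo]), and sums
    keep a strict drop in one summand when the other weakly drops ([lt_le_add], [le_lt_add]). With
    the formulas for juxtaposition and plugging this gives the four compatibility lemmas.
    Termination of [>] is inherited from [M] by evaluating heat at a fixed point, and a reduction
    step is a 3-cell in a context, so it descends for [>]. *)

Section TupleOrder.
Context (d : Order.disp_t) (T : porderType d).

Lemma le_tupleP n (x y : n.-tuple T) :
  reflect (forall i, tnth x i <= tnth y i) (x <= y).
Proof. by rewrite leEtprod; apply: forallP. Qed.

Lemma tnth_lblock m n (x : (m + n).-tuple T) i :
  tnth (lblock x) i = tnth x (lshift n i).
Proof.
(* [T] may be empty, but the index [i] witnesses an entry, which serves as the default of [nth]. *)
have x0 := tnth (lblock x) i.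
by rewrite !(tnth_nth x0) /= nth_take.
Qed.

Lemma tnth_rblock m n (x : (m + n).-tuple T) i :
  tnth (rblock x) i = tnth x (rshift m i).
Proof.
have x0 := tnth (rblock x) i.
by rewrite !(tnth_nth x0) /= nth_drop.
Qed.

Lemma le_lblock m n (x y : (m + n).-tuple T) : x <= y -> lblock x <= lblock y.
Proof.
by move=> /le_tupleP xy; apply/le_tupleP => i; rewrite !tnth_lblock.
Qed.

Lemma le_rblock m n (x y : (m + n).-tuple T) : x <= y -> rblock x <= rblock y.
Proof.
by move=> /le_tupleP xy; apply/le_tupleP => i; rewrite !tnth_rblock.
Qed.

Lemma le_cat_tuple m n (x x' : m.-tuple T) (y y' : n.-tuple T) :
  x <= x' -> y <= y' -> [tuple of x ++ y] <= [tuple of x' ++ y'].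
Proof.
move=> /le_tupleP xx' /le_tupleP yy'; apply/le_tupleP => i.
by case: (split_ordP i) => j ->; rewrite ?tnth_lshift ?tnth_rshift.
Qed.

End TupleOrder.

Section Monotonicity.
Context (S : polygraph2) (dX dY dM : Order.disp_t).
Context (X : porderType dX) (Y : porderType dY) (M : porderType dM).
Context (zero : M) (add : Monoid.com_law zero).
Context (I : interp S X Y M) (I_mono : monotone I).
Context (add_mono : forall a a' b : M, a < a' ->
  add a b < add a' b /\ add b a < add b a').

(** Only strict monotonicity is assumed, so each inequality is split into equality or strictness; if
    both are strict, the chain goes through [add a' b]. *)
Lemma le_add a a' b b' : a <= a' -> b <= b' -> add a b <= add a' b'.
Proof.
rewrite !le_eqVlt => /predU1P[-> | /add_mono aa'] /predU1P[-> | /add_mono bb'].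
- by rewrite eqxx.
- by rewrite (proj2 (bb' _)) orbT.
- by rewrite (proj1 (aa' _)) orbT.
- by rewrite (lt_trans (proj1 (aa' b)) (proj2 (bb' a'))) orbT.
Qed.

Lemma lt_le_add a a' b b' : a < a' -> b <= b' -> add a b < add a' b'.
Proof.
by move=> /add_mono aa' bb'; apply: lt_le_trans (proj1 (aa' b)) (le_add _ bb').
Qed.

Lemma le_lt_add a a' b b' : a <= a' -> b < b' -> add a b < add a' b'.
Proof.
by move=> aa' /add_mono bb'; apply: lt_le_trans (proj2 (bb' a)) (le_add aa' _).
Qed.

(** Terms allow induction; circuits are covered because [ccov] is [tcov] of a representative. *)
Lemma tcov_homo m n (f : term S m n) : {homo tcov I f : x x' / x <= x'}.
Proof.
have [cov_homo _ _] := I_mono.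
elim: f => {m n} /= [c | n | m n m' n' f IHf g IHg | m n p f IHf g IHg] x x' xx'.
- exact: cov_homo.
- by [].
- by apply: le_cat_tuple; [apply/IHf/le_lblock | apply/IHg/le_rblock].
- exact/IHg/IHf.
Qed.

Lemma tcontra_homo m n (f : term S m n) : {homo tcontra I f : y y' / y <= y'}.
Proof.
have [_ contra_homo _] := I_mono.
elim: f => {m n} /= [c | n | m n m' n' f IHf g IHg | m n p f IHf g IHg] y y' yy'.
- exact: contra_homo.
- by [].
- by apply: le_cat_tuple; [apply/IHf/le_lblock | apply/IHg/le_rblock].
- exact/IHf/IHg.
Qed.

Lemma theat_homo m n (f : term S m n) x x' y y' :
  x <= x' -> y <= y' -> theat add I f x y <= theat add I f x' y'.
Proof.
have [_ _ heat_homo] := I_mono.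
elim: f x x' y y' => {m n} /=
  [c | n | m n m' n' f IHf g IHg | m n p f IHf g IHg] x x' y y' xx' yy'.
- exact: heat_homo.
- by [].
- by apply: le_add; [apply: IHf; apply: le_lblock | apply: IHg; apply: le_rblock].
- by apply: le_add; [apply: IHf => //; apply: tcontra_homo
                    | apply: IHg => //; apply: tcov_homo].
Qed.

Local Notation gt := (interp_gt add I).

Lemma interp_gt_trans m n (f g h : circuit S m n) :
  gt f g -> gt g h -> gt f h.
Proof.
move=> fg gh x y; have [fg1 fg2 fg3] := fg x y; have [gh1 gh2 gh3] := gh x y.
by split; [apply: le_trans fg1 | apply: le_trans fg2 | apply: lt_trans fg3].
Qed.

Lemma interp_gt_juxtl m n m' n' (f : circuit S m n) (g h : circuit S m' n') :
  gt g h -> gt (juxt f g) (juxt f h).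
Proof.
move=> gh x y; have [gh1 gh2 gh3] := gh (rblock x) (rblock y).
rewrite !ccov_juxt !ccontra_juxt !cheat_juxt.
by split; [apply: le_cat_tuple | apply: le_cat_tuple | apply: le_lt_add].
Qed.

Lemma interp_gt_juxtr m n m' n' (f : circuit S m n) (g h : circuit S m' n') :
  gt g h -> gt (juxt g f) (juxt h f).
Proof.
move=> gh x y; have [gh1 gh2 gh3] := gh (lblock x) (lblock y).
rewrite !ccov_juxt !ccontra_juxt !cheat_juxt.
by split; [apply: le_cat_tuple | apply: le_cat_tuple | apply: lt_le_add].
Qed.

(** The heats of [g] and [h] are compared at the same input [ccov I f x], hence strictly; that of
    [f] weakly drops, since [h] sends it a smaller [ccontra] value. *)
Lemma interp_gt_plugl m n p (f : circuit S m n) (g h : circuit S n p) :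
  gt g h -> gt (plug f g) (plug f h).
Proof.
move=> gh x y; have [gh1 gh2 gh3] := gh (ccov I f x) y.
rewrite !ccov_plug !ccontra_plug !cheat_plug; split => //.
- exact: tcontra_homo.
- by apply: le_lt_add => //; apply: theat_homo.
Qed.

Lemma interp_gt_plugr m n p (f : circuit S n p) (g h : circuit S m n) :
  gt g h -> gt (plug g f) (plug h f).
Proof.
move=> gh x y; have [gh1 gh2 gh3] := gh x (ccontra I f y).
rewrite !ccov_plug !ccontra_plug !cheat_plug; split => //.
- exact: tcov_homo.
- by apply: lt_le_add => //; apply: theat_homo.
Qed.

Lemma interp_gt_termination_order : inhabited X -> inhabited Y ->
  ~ (exists u : nat -> M, forall k, u k > u k.+1) ->
  termination_order gt.
Proof.
move=> [x0] [y0] M_wf; split.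
(* Constant tuples provide arguments in every arity, so the universally quantified relation is never
   vacuous. *)
- move=> m n f /(_ [tuple of nseq m x0] [tuple of nseq n y0]) [_ _].
  by rewrite ltxx.
- exact: interp_gt_trans.
- move=> [m [n [f f_chain]]]; apply: M_wf.
  exists (fun k => cheat add I (f k) [tuple of nseq m x0] [tuple of nseq n y0]).
  by move=> k; have [] := f_chain k [tuple of nseq m x0] [tuple of nseq n y0].
- exact: interp_gt_juxtl.
- exact: interp_gt_juxtr.
- exact: interp_gt_plugl.
- exact: interp_gt_plugr.
Qed.

End Monotonicity.

Lemma termination_order_terminates (P : polygraph3) (gt : circuit_rel P) :
  termination_order gt -> (forall a : cell3 P, gt _ _ (lhs a) (rhs a)) ->
  terminates P.
Proof.
move=> [_ _ gt_wf gt_juxtl gt_juxtr gt_plugl gt_plugr] gt_cell [m [n [f f_chain]]].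
apply: gt_wf; exists m, n, f => k.
have [a [p [q [h [h' [-> ->]]]]]] := f_chain k.
(* The context is peeled from the outside in: [k] below, [h] above, then the [q] and [p] identity
   wires. *)
exact/gt_plugr/gt_plugl/gt_juxtr/gt_juxtl/gt_cell.
Qed.

Theorem theorem2p3 (P : polygraph3) (dX dY dM : Order.disp_t)
    (X : porderType dX) (Y : porderType dY) (M : porderType dM)
    (zero : M) (add : Monoid.com_law zero) (I : interp P X Y M)
    (X_nonempty : inhabited X) (Y_nonempty : inhabited Y)
    (add_mono : forall a a' b : M, (a < a')%O ->
      (add a b < add a' b)%O /\ (add b a < add b a')%O)
    (I_mono : monotone I)
    (M_wf : ~ exists u : nat -> M, forall k, (u k > u k.+1)%O) :
  termination_order (interp_gt add I) /\
  ((forall a : cell3 P, interp_gt add I (lhs a) (rhs a)) -> terminates P).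
Proof.
have gt_term : termination_order (interp_gt add I).
  exact: interp_gt_termination_order.
by split=> //; apply: termination_order_terminates.
Qed.
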